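(* Let $G$ be a connected plane bipartite graph with color classes $E$ and $V$, let $G^*$ be its directed planar dual, and fix a vertex $r_0$ of $G^*$. Consider the triangulation of the root polytope $Q_G$ consisting of the simplices $\sigma_A=\operatorname{Conv}\{\mathbf e+\mathbf v\mid ev\in\Gamma_A\}$, where $A$ ranges over all spanning arborescences of $G^*$ rooted at $r_0$ and $\Gamma_A$ is the spanning tree of $G$ dual to $A$. This triangulation is shellable.
   Context: All graphs are finite; multiple edges are allowed. A plane graph is a graph embedded in the plane, equivalently in the oriented sphere $S^2$. Dual graph: the vertex set of $G^*$ is the set $R$ of regions of $G$ (connected components of $S^2\setminus G$), and $G^*$ has one edge crossing each edge of $G$. Each edge of $G^*$ is directed so that, traversing it, one has the endpoint in $E$ of the crossed edge of $G$ on the right and the endpoint in $V$ on the left. $G^*$ may have loops and multiple edges. Spanning arborescence of $G^*$ rooted at $r_0$: a spanning tree of $G^*$ in which there is a directed path from $r_0$ to every other vertex. The dual subgraph $\Gamma_A$ of $A$ consists of those edges of $G$ whose dual edges are not in $A$; it is a spanning tree of $G$. Root polytope: for $e\in E$, $v\in V$ let $\mathbf e,\mathbf v$ be the corresponding standard generators of $\mathbf R^E\oplus\mathbf R^V$, and $Q_G=\operatorname{Conv}\{\mathbf e+\mathbf v\mid ev\text{ is an edge of }G\}$, a polytope of dimension $|E|+|V|-2$. A triangulation of $Q_G$ is a collection of maximal-dimensional simplices, with vertices among the vertices of $Q_G$, whose union is $Q_G$ and any two of which intersect in a common face. The simplices $\sigma_A$ form such a triangulation. Shellable: a pure simplicial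 complex (all maximal simplices have the same dimension) is shellable if its maximal simplices admit a shelling order, i.e. a linear order $\sigma_1<\sigma_2<\cdots<\sigma_m$ such that each $\sigma_i$ intersects $\sigma_1\cup\cdots\cup\sigma_{i-1}$ in a union of $c_i$ codimension one faces of $\sigma_i$, where $c_1=0$ and $c_i\ge1$ for $i\ge2$. *)

(* Defs.v *)
From HB Require Import structures.
From mathcomp Require Import all_boot all_order all_algebra all_fingroup.
From mathcomp Require Import finmap.
From mathcomp Require Import boolp classical_sets reals.

Set Implicit Arguments.
Unset Strict Implicit.
Unset Printing Implicit Defensive.

Import Order.TTheory GRing.Theory Num.Theory.
Local Open Scope ring_scope.

(** * Finite directed multigraphs; loops and parallel edges are allowed *)

Record digraph := Digraph {
  vertex : finType;
  edge : finType;
  tail : edge -> vertex;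
  head : edge -> vertex
}.

Section Digraph.
Variable H : digraph.
Implicit Types (A : {set edge H}) (x y : vertex H).

Definition arrow A : rel (vertex H) :=
  fun x y => [exists a in A, (tail a == x) && (head a == y)].

Definition adjacent A : rel (vertex H) :=
  fun x y => arrow A x y || arrow A y x.

(* The spanning subgraph with edge set A is connected, directions ignored. *)
Definition connects A : Prop := forall x y, connect (adjacent A) x y.

(* A step is an edge with a direction of traversal, [true] meaning from tail
   to head. *)
Definition step_src (s : edge H * bool) := if s.2 then tail s.1 else head s.1.
Definition step_tgt (s : edge H * bool) := if s.2 then head s.1 else tail s.1.

(* Cycles of the underlying undirected multigraph: nonempty closed walks that
   repeat neither an edge nor a vertex. A loop is a cycle of length 1, a pair of
   parallel edges a cycle of length 2. *)
Definition is_cycle (c : seq (edge H * bool)) : bool :=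
  [&& c != [::], path.cycle (fun s t => step_tgt s == step_src t) c,
      uniq (map fst c) & uniq (map step_src c)].

Definition acyclic A : Prop :=
  forall c : seq (edge H * bool), is_cycle c -> ~~ all (mem A) (map fst c).

Definition spanning_tree A : Prop := connects A /\ acyclic A.

Definition spanning_arborescence (r0 : vertex H) A : Prop :=
  spanning_tree A /\ forall r, connect (arrow A) r0 r.

End Digraph.

(** * Bipartite graphs embedded in an oriented surface *)

(* The embedding is recorded by the cyclic order of the edges around every
   vertex: [rotE d] (resp. [rotV d]) is the edge that follows [d]
   counterclockwise around the endpoint of [d] in E (resp. in V). *)
Record bimap := Bimap {
  colE : finType;
  colV : finType;
  bedge : finType;
  endE : bedge -> colE;
  endV : bedge -> colV;
  rotE : {perm bedge};
  rotV : {perm bedge};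
  porbit_rotE : forall d, porbit rotE d = [set d' | endE d' == endE d]%SET;
  porbit_rotV : forall d, porbit rotV d = [set d' | endV d' == endV d]%SET
}.

Definition bigraph (G : bimap) : digraph :=
  @Digraph (colE G + colV G)%type (bedge G)
    (fun d => inl (endE d)) (fun d => inr (endV d)).

Definition connected_bimap (G : bimap) : Prop :=
  @connects (bigraph G) [set: bedge G]%SET.

(* Walk along an edge d from E to V with a region on the left. At the V-end,
   the boundary of this region continues along d' = rotV^-1 d, traversed from V
   to E, and then along rotE^-1 d', traversed from E to V. The regions are thus
   the orbits of the inverse permutation, which is rotE followed by rotV; a
   region is encoded as the set of edges having it on their left when they are
   oriented from E to V. A connected graph without edges is a point and has one
   region. *)
Definition face_perm (G : bimap) : {perm bedge G} := (rotE G * rotV G)%g.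

Definition regions (G : bimap) : {set {set bedge G}} :=
  if #|bedge G| == 0%N then [set finset.set0]%SET else porbits (face_perm G).

(* A connected graph with given rotations is embedded in the sphere if and only
   if it satisfies Euler's formula. *)
Definition planar (G : bimap) : Prop :=
  (#|colE G| + #|colV G| + #|regions G| = #|bedge G| + 2)%N.

Lemma left_subproof (G : bimap) (d : bedge G) :
  porbit (face_perm G) d \in regions G.
Proof.
rewrite /regions ifN; first exact: imset_f.
by rewrite -lt0n; apply/card_gt0P; exists d.
Qed.

Definition region (G : bimap) : finType := {r | r \in regions G}.

(* The regions on the two sides of an edge oriented from E to V. *)
Definition left_region (G : bimap) (d : bedge G) : region G :=
  Sub (porbit (face_perm G) d) (left_subproof d).

Definition right_region (G : bimap) (d : bedge G) : region G :=
  left_region (rotV G d).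

(* Crossing d with its E-end on the right and its V-end on the left means going
   from the left side of d, oriented from E to V, to its right side. *)
Definition dual_graph (G : bimap) : digraph :=
  @Digraph (region G) (bedge G) (@left_region G) (@right_region G).

(* Edges of the dual are identified with the edges of G that they cross. *)
Definition dual_subgraph (G : bimap) (A : {set edge (dual_graph G)}) :
  {set bedge G} := (~: A)%SET.

(** * Geometric simplicial complexes *)

Section Complexes.
Variables (R : realType) (T : lmodType R).
Implicit Types (s t : {fset T}) (P : set T) (K : {fset {fset T}}).
Local Open Scope classical_set_scope.

Definition conv s : set T :=
  [set x | exists w : T -> R,
    [/\ forall p, p \in s -> 0 <= w p, \sum_(p <- s) w p = 1 &
        x = \sum_(p <- s) w p *: p]].

Definition affinely_independent s : Prop :=
  forall w : T -> R, \sum_(p <- s) w p = 0 -> \sum_(p <- s) w p *: p = 0 ->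
  forall p, p \in s -> w p = 0.

Definition polytope_vertex P (p : T) : Prop :=
  P p /\ forall (x y : T) (a : R), P x -> P y -> 0 < a < 1 ->
           p = a *: x + (1 - a) *: y -> x = p /\ y = p.

(* A simplex is given by its vertex set s, so its dimension is #|` s| - 1. *)
Definition max_dimensional P s : Prop :=
  affinely_independent s /\
  forall t, [set` t] `<=` P -> affinely_independent t -> (#|` t| <= #|` s|)%N.

(* The empty face is allowed. *)
Definition face_of (X : set T) s : Prop := exists2 t, (t `<=` s)%fset & X = conv t.

Definition meet_in_common_face s t : Prop :=
  face_of (conv s `&` conv t) s /\ face_of (conv s `&` conv t) t.

(* K lists the vertex sets of the maximal simplices. *)
Definition pure_simplicial_complex K : Prop :=
  [/\ forall s, s \in K -> affinely_independent s,
      forall s t, s \in K -> t \in K -> #|` s| = #|` t| &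
      forall s t, s \in K -> t \in K -> meet_in_common_face s t].

Definition triangulation P K : Prop :=
  [/\ forall s, s \in K -> max_dimensional P s,
      forall s, s \in K -> forall p, p \in s -> polytope_vertex P p,
      \bigcup_(s in [set` K]) conv s = P &
      forall s t, s \in K -> t \in K -> meet_in_common_face s t].

Definition codim1_face t s : Prop := (t `<=` s)%fset /\ #|` s| = #|` t|.+1.

(* Positions are counted from 0, and c_i is the cardinality of F. *)
Definition shelling_order (l : seq {fset T}) : Prop :=
  forall i, (i < size l)%N ->
  exists F : {fset {fset T}},
    [/\ forall t, t \in F -> codim1_face t (nth fset0 l i),
        conv (nth fset0 l i) `&` \bigcup_(j in [set j | (j < i)%N])
          conv (nth fset0 l j) = \bigcup_(t in [set` F]) conv t &
        if i == 0%N then #|` F| = 0%N else (1 <= #|` F|)%N].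

Definition shellable K : Prop :=
  pure_simplicial_complex K /\
  exists l : seq {fset T}, [/\ uniq l, l =i K & shelling_order l].

End Complexes.

(** * The root polytope *)

Section RootPolytope.
Variables (R : realType) (G : bimap).

Definition point_space : lmodType R := {ffun (colE G + colV G)%type -> R^o}.

Definition generator (x : colE G + colV G) : point_space :=
  [ffun y => (y == x)%:R].

Definition edge_point (d : bedge G) : point_space :=
  generator (inl (endE d)) + generator (inr (endV d)).

Definition edge_points (S : {set bedge G}) : {fset point_space} :=
  [fset edge_point d | d in S]%fset.

Definition root_polytope : set point_space := conv (edge_points [set: bedge G]%SET).

(* The simplices sigma_A, each given by its vertex set. *)
Definition arborescence_simplices (r0 : region G) : {fset {fset point_space}} :=
  [fset edge_points (dual_subgraph A) | A in
    [pred A : {set edge (dual_graph G)} |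
      `[< @spanning_arborescence (dual_graph G) r0 A >]]]%fset.

End RootPolytope.

Arguments root_polytope R G : clear implicits.
Arguments arborescence_simplices R [G] r0.

(* Main.v *)
(** Let [A] and [B] be arborescences. Two nonnegative combinations [a], [b] of edge
points that are supported on the trees dual to [A] and [B] and give the same point
differ by a real 1-cycle of [G], which by planarity is the coboundary of a function
[g] on regions. On [A] the difference [a - b] is nonpositive, so [g] is
nondecreasing along the paths of [A]; likewise it is nonincreasing along those of
[B]. Hence [g] is constant and [a = b]. This yields affine independence and the intersection
in common faces. For the covering, view the coefficients [a >= 0] of a point of
the root polytope as lengths of the dual edges: subtracting the coboundary of the
distances from [r0] leaves nonnegative coefficients that vanish on a shortest-path
arborescence.

For the shelling, give the dual edges the lengths 1, 2, 4, ... and order the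
arborescences by the sum over all regions of the distance from [r0] inside the
arborescence. If [B] is not after [A] and differs from it, some edge [d] of [B]
is a shortcut for [A]; exchanging it for the edge of [A] with the same head gives
an earlier arborescence [C], and the simplices of [A] and [C] meet in the facet
of the simplex of [A] opposite to [d]. *)

From mathcomp Require Import all_boot all_order all_algebra all_fingroup.
From mathcomp Require Import lra.
Require Import Defs.

Set Implicit Arguments.
Unset Strict Implicit.
Unset Printing Implicit Defensive.

Import Order.TTheory GRing.Theory Num.Theory.
Local Open Scope ring_scope.

(** * Induction along directed paths *)

Lemma connect_ind_r (T : finType) (e : rel T) (x : T) (P : T -> Prop) :
  P x -> (forall y z, connect e x y -> P y -> e y z -> P z) ->
  forall y, connect e x y -> P y.
Proof.
move=> Px Pe y /connectP[p]; elim/last_ind: p y => [|p z IHp] y.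
  by move=> _ ->.
rewrite rcons_path last_rcons => /andP[xp ez] ->.
apply: Pe (IHp _ xp erefl) ez; apply/connectP; by exists p.
Qed.

Lemma connect_last (T : finType) (e : rel T) (x y : T) :
  connect e x y -> x = y \/ exists2 z, connect e x z & e z y.
Proof.
move=> xy; elim/connect_ind_r: xy; first by left.
by move=> z t xz _ zt; right; exists z.
Qed.

(** * Arborescences as reachability together with an edge count *)

Section Branching.
Variables (H : digraph) (r0 : vertex H).
Implicit Types (A B : {set edge H}) (r : vertex H) (d : edge H).

(* The bound on the number of edges stands for acyclicity. *)
Definition branching A :=
  (forall r, connect (arrow A) r0 r) /\ (#|A| < #|vertex H|)%N.

Lemma arrowP A x y :
  reflect (exists2 d, d \in A & tail d = x /\ head d = y) (arrow A x y).
Proof.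
apply: (iffP existsP) => [[d /and3P[dA /eqP<- /eqP<-]]|[d dA [<- <-]]].
  by exists d.
by exists d; rewrite dA !eqxx.
Qed.

Lemma edge_arrow A d : d \in A -> arrow A (tail d) (head d).
Proof. by move=> dA; apply/arrowP; exists d. Qed.

Lemma in_edge A r : connect (arrow A) r0 r -> r != r0 ->
  exists2 d, d \in A & head d = r.
Proof.
move=> /connect_last[->|[z _ /arrowP[d dA [_ <-]]]]; first by rewrite eqxx.
by exists d.
Qed.

(** Reachability puts a head at each of the [#|vertex H| - 1] vertices other than [r0]; the bound on
    [#|A|] leaves no room for a second edge into a vertex or for one into [r0]. *)
Lemma branching_heads A : branching A ->
  @head H @: A = [set~ r0]%SET /\ {in A &, injective (@head H)}.
Proof.
case=> reachA ltA.
have sub : ([set~ r0] \subset @head H @: A)%SET.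
  apply/fintype.subsetP => r; rewrite !inE => /(in_edge (reachA r))[d dA <-].
  exact: imset_f.
have c0 : #|[set~ r0]%SET| = #|vertex H|.-1 by rewrite cardsC1.
have leA : (#|A| <= #|[set~ r0]%SET|)%N.
  by rewrite c0 -ltnS prednK //; apply: leq_ltn_trans ltA.
have eqA : @head H @: A = [set~ r0]%SET.
  apply/esym/eqP; rewrite eqEcard sub /=.
  exact: leq_trans (leq_imset_card _ _) leA.
by split=> //; apply/imset_injP; rewrite eqn_leq leq_imset_card eqA.
Qed.

Section BranchingTheory.
Variables (A : {set edge H}) (brA : branching A).

Let reachA r : connect (arrow A) r0 r. Proof. by case: brA. Qed.

Lemma head_inj : {in A &, injective (@head H)}.
Proof. by case: (branching_heads brA). Qed.

Lemma head_neq_root d : d \in A -> head d != r0.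
Proof.
move=> dA; have: head d \in @head H @: A by apply: imset_f.
by case: (branching_heads brA) => -> _; rewrite !inE.
Qed.

Lemma branching_connect_last x d : d \in A -> connect (arrow A) x (head d) ->
  x = head d \/ connect (arrow A) x (tail d).
Proof.
move=> dA /connect_last[->|[z xz /arrowP[d' d'A [tz hd]]]]; first by left.
by right; rewrite -(head_inj d'A dA hd) tz.
Qed.

Lemma connect_root x : connect (arrow A) x r0 -> x = r0.
Proof.
move=> /connect_last[//|[z _ /arrowP[d dA [_ /eqP]]]].
by rewrite (negPf (head_neq_root dA)).
Qed.

(** If [head d] reached [tail d], the vertices reachable from [head d] would be closed under
    predecessors along [A], because heads are distinct. They avoid [r0], so no path from [r0] could
    enter this set. *)
Lemma branching_acyclic d : d \in A -> ~~ connect (arrow A) (head d) (tail d).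
Proof.
move=> dA; apply/negP => dd.
suff C r : ~~ connect (arrow A) (head d) r by move: (C (head d)); rewrite connect0.
elim/connect_ind_r: (reachA r) => [|y z _ NCy /arrowP[d' d'A [ty hz]]].
  by apply/negP => /connect_root/eqP; rewrite (negPf (head_neq_root dA)).
apply/negP; rewrite -hz => /(branching_connect_last d'A)[hd|]; last first.
  by rewrite ty (negPf NCy).
by move: NCy; rewrite -ty -(head_inj dA d'A hd) dd.
Qed.

(* The edges of the path from the root to [r]. *)
Definition path_edges r := [set d in A | connect (arrow A) (head d) r]%SET.

Lemma path_edges_root : path_edges r0 = set0.
Proof.
apply/setP => d; rewrite !inE; apply/negP => /andP[dA /connect_root/eqP].
by rewrite (negPf (head_neq_root dA)).
Qed.

Lemma path_edges_head d : d \in A ->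
  path_edges (head d) = (d |: path_edges (tail d))%SET.
Proof.
move=> dA; apply/setP => d'; rewrite !inE.
apply/andP/orP => [[d'A /(branching_connect_last dA)[hd|c]]|[/eqP->|/andP[d'A c]]].
- by left; rewrite (head_inj d'A dA hd).
- by right; rewrite d'A.
- by rewrite dA connect0.
- by rewrite d'A (connect_trans c) // connect1 // edge_arrow.
Qed.

Lemma path_edges_tail d : d \in A -> d \notin path_edges (tail d).
Proof. by move=> dA; rewrite inE dA branching_acyclic. Qed.

End BranchingTheory.

(** Depth strictly increases along the edges of [A]. At a deepest vertex of an undirected cycle,
    both adjacent edges of the cycle point into that vertex, hence coincide. *)
Lemma branching_tree A : branching A -> spanning_arborescence r0 A.
Proof.
move=> brA; have [reachA _] := brA; split=> //; split.
  move=> x y; have sym : connect_sym (adjacent A).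
    by apply: sym_connect_sym => {}x {}y; rewrite /adjacent orbC.
  have r0c z : connect (adjacent A) r0 z.
    apply: connect_sub (reachA z) => u v uv; apply: connect1.
    by rewrite /adjacent uv.
  by rewrite (connect_trans _ (r0c y)) // sym r0c.
move=> c; rewrite /is_cycle.
move=> /and4P[cN0 cyc uc _]; apply/negP => allA.
pose dep r := #|path_edges A r|.
have depS d : d \in A -> (dep (tail d) < dep (head d))%N.
  by move=> dA; rewrite /dep (path_edges_head brA dA) cardsU1 path_edges_tail.
have [s0 s0c] : exists s, s \in c.
  by case: (c) cN0 => // s c' _; exists s; rewrite mem_head.
have [s sc smax] : exists2 s, s \in c &
    forall t, t \in c -> (dep (step_src t) <= dep (step_src s))%N.
  case: (arg_maxnP (fun t => dep (step_src t)) s0c) => s sc smax.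
  by exists s.
(* The cycle is rotated to start at a deepest vertex: [s] leaves it and the last step [t] returns to
   it. *)
have [i c' rc] := rot_to sc.
have memE t : (t \in c) = (t \in s :: c') by rewrite -rc mem_rot.
have cyc' : path.cycle (fun s t => step_tgt s == step_src t) (s :: c').
  by rewrite -rc rot_cycle.
have uc' : uniq (map fst (s :: c')) by rewrite -rc map_rot rot_uniq.
have inA t : t \in s :: c' -> t.1 \in A.
  by rewrite -memE => tc; move/allP: allA; apply; apply: map_f.
have hs : head s.1 = step_src s.
  have [t tc ts] : exists2 t, t \in s :: c' & step_src t = step_tgt s.
    move: cyc'; case: (c') => [|t c'']; rewrite /= => /andP[/eqP-> _].
      by exists s; rewrite ?mem_head.
    by exists t; rewrite ?inE ?eqxx ?orbT.
  have := smax t; rewrite memE tc ts /step_src /step_tgt => /(_ isT).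
  case: (s.2) => //; rewrite leqNgt depS // inA ?mem_head //.
have [t tc ts] : exists2 t, t = last s c' & step_tgt t = step_src s.
  by exists (last s c') => //; move: cyc'; rewrite /= rcons_path => /andP[_ /eqP].
have tin : t \in s :: c' by rewrite tc mem_last.
have ht : head t.1 = step_tgt t.
  have := smax t; rewrite memE tin -ts => /(_ isT).
  rewrite /step_src /step_tgt; case: (t.2) => //; rewrite leqNgt depS //.
  exact: inA.
have st : s.1 = t.1.
  by apply: (head_inj brA); rewrite ?inA ?mem_head // hs ht.
(* A cycle of length one is a loop, which strict growth of depth forbids; a longer one would repeat
   the edge [s.1]. *)
case: c' => [|s' c'] in rc memE cyc' uc' inA tc tin *.
  have := depS s.1 (inA _ (mem_head _ _)).
  move: ts; rewrite tc /= /step_tgt /step_src.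
  by case: (s.2) => ->; rewrite ltnn.
move: uc'; rewrite map_cons cons_uniq => /andP[/negP[]].
by rewrite st tc map_f //= mem_last.
Qed.

(** The chain condition is stated behind an arbitrary step ending at [x], so that one more edge can
    be put in front to close a cycle. A later step along the first edge would revisit [x], so the
    edges are distinct. *)
Lemma path_steps A x p : path (adjacent A) x p -> uniq (x :: p) ->
  exists c : seq (edge H * bool),
  [/\ map (@step_src H) c = belast x p, map (@step_tgt H) c = p,
      forall s, step_tgt s = x ->
        path (fun s t => step_tgt s == step_src t) s c,
      all (mem A) (map fst c) & uniq (map fst c)].
Proof.
elim: p x => [|y p IHp] x /=; first by exists [::].
move=> /andP[xy yp] /andP[xNp uyp].
have [c [srcE tgtE pc cA uc]] := IHp y yp uyp.
have [s sA [sx sy]] : exists2 s : edge H * bool, s.1 \in A &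
    step_src s = x /\ step_tgt s = y.
  case/orP: xy => /arrowP[d dA [td hd]]; first by exists (d, true).
  by exists (d, false).
exists (s :: c); split=> /=.
- by rewrite sx srcE.
- by rewrite sy tgtE.
- by move=> t ->; rewrite sx eqxx /=; apply: pc.
- by rewrite sA cA.
rewrite uc andbT; apply/mapP => -[t tc st].
have srct : step_src t \in y :: p.
  by apply: mem_belast; rewrite -srcE map_f.
have tgtt : step_tgt t \in y :: p.
  by rewrite inE -[in X in _ || X]tgtE map_f ?orbT.
move/negP: xNp; apply; rewrite -sx; move: srct tgtt.
by rewrite /step_src /step_tgt st; case: (s.2); case: (t.2).
Qed.

(** A path from [head d] to [tail d] avoiding [d], once shortened to repeat no vertex, would be
    closed by [d] to a cycle in [A]. *)
Lemma acyclic_connect A d : acyclic A -> d \in A ->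
  ~~ connect (adjacent (A :\ d)%SET) (head d) (tail d).
Proof.
move=> acA dA; apply/negP => /connectP[p hp tE].
move: tE; case: (shortenP hp) => {}p {}hp uhp _ tE.
have [c [srcE tgtE pc cA uc]] := path_steps hp uhp.
have ac := acA ((d, true) :: c); move: ac.
have -> : is_cycle ((d, true) :: c).
  rewrite /is_cycle /= rcons_path pc //= uc srcE.
  have -> : step_tgt (last (d, true) c) = step_src (d, true).
    by rewrite -(last_map (@step_tgt H)) tgtE.
  rewrite eqxx /= andbT; apply/andP; split.
    apply/negP => /(allP cA); by rewrite !inE eqxx.
  move: uhp; rewrite [step_src _]tE lastI rcons_uniq => /andP[-> /= ->].
  done.
move=> /(_ isT)/negP; apply; rewrite /= dA.
by apply/allP => e /(allP cA); rewrite !inE => /andP[].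
Qed.

End Branching.

(** * Shortest-path arborescences *)

(** Zero lengths extract an arborescence from any edge set that reaches every vertex; lengths given
    by the coefficients of a point yield the covering of the polytope. *)
Lemma shortest_path_tree (R : realDomainType) (H : digraph) (r0 : vertex H)
    (B : {set edge H}) (a : edge H -> R) :
  (forall d, d \in B -> 0 <= a d) -> (forall r, connect (arrow B) r0 r) ->
  exists (h : vertex H -> R) (A : {set edge H}),
    [/\ A \subset B, branching r0 A,
        forall d, d \in B -> h (head d) <= h (tail d) + a d &
        forall d, d \in A -> h (head d) = h (tail d) + a d].
Proof.
move=> a_ge0 reachB.
(* Grow the tree [A] on the vertex set [S], raising the potential [h] outside
   [S] until an edge leaving [S] becomes tight. *)
suff grow n (S : {set vertex H}) h (A : {set edge H}) : (#|~: S| <= n)%N ->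
    [/\ r0 \in S, forall r, r \in S -> connect (arrow A) r0 r,
        forall d, d \in A -> tail d \in S /\ head d \in S & (#|A| < #|S|)%N] ->
    [/\ A \subset B,
        forall d, d \in B -> h (head d) <= h (tail d) + a d &
        forall d, d \in A -> h (head d) = h (tail d) + a d] ->
    exists (h : vertex H -> R) (A : {set edge H}),
    [/\ A \subset B, branching r0 A,
        forall d, d \in B -> h (head d) <= h (tail d) + a d &
        forall d, d \in A -> h (head d) = h (tail d) + a d].
  apply: (grow #|~: [set r0]|%SET [set r0]%SET (fun=> 0) set0) => //.
    split; [by rewrite inE| |by move=> d; rewrite in_set0|by rewrite cards0 cards1].
    by move=> r /set1P->; apply: connect0.
  split; rewrite ?sub0set //; last by move=> d; rewrite in_set0.
  by move=> d dB; rewrite add0r a_ge0.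
elim: n S h A => [|n IHn] S h A leS [r0S reachS endS ltA] [AB feas tight];
  (have [ST|SNT] := eqVneq S [set: _]%SET;
    first by exists h, A; split=> //; split=> [r|];
      [apply: reachS; rewrite ST inE | rewrite -cardsT -ST]).
  case/eqP: SNT; apply/setP => r; rewrite [RHS]inE.
  by move: leS; rewrite leqn0 => /eqP/card0_eq/(_ r); rewrite inE => /negbFE.
pose P d := [&& d \in B, tail d \in S & head d \notin S].
(* Otherwise [S] would be closed under the edges of [B] and contain everything reachable from
   [r0]. *)
have [d0 Pd0] : exists d, P d.
  apply/existsP; apply: contraR SNT => /existsPn NP.
  apply/eqP/setP => r; rewrite [RHS]inE.
  elim/connect_ind_r: (reachB r) => // y z _ yS /arrowP[d dB [ty hz]].
  by have := NP d; rewrite /P dB ty yS hz negbK.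
pose slack d := h (tail d) + a d - h (head d).
have [d /and3P[dB tS hS] dmin] := @arg_minP _ _ _ d0 P slack Pd0.
have slack_ge0 e : e \in B -> 0 <= slack e.
  by move=> eB; rewrite /slack subr_ge0 feas.
pose h' r := h r + (if r \in S then 0 else slack d).
apply: (IHn (head d |: S)%SET h' (d |: A)%SET).
- rewrite -ltnS (leq_trans _ leS) // proper_card // properE setCS subsetUr.
  by apply/subsetPn; exists (head d); rewrite !inE ?eqxx.
- have sub r : connect (arrow A) r0 r -> connect (arrow (d |: A)%SET) r0 r.
    apply: connect_sub => x y /arrowP[e eA [<- <-]].
    by apply/connect1/edge_arrow; rewrite !inE eA orbT.
  split.
  + by rewrite !inE r0S orbT.
  + move=> r; rewrite !inE => /orP[/eqP->|/reachS/sub //].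
    apply: connect_trans (sub _ (reachS _ tS)) _.
    by apply/connect1/edge_arrow; rewrite !inE eqxx.
  + move=> e; rewrite !inE => /orP[/eqP->|/endS[-> ->]]; last by rewrite !orbT.
    by rewrite tS eqxx orbT.
  + have dA : d \notin A by apply: contra hS => /endS[].
    by rewrite !cardsU1 dA hS.
- split.
  + by rewrite subUset sub1set dB.
  (* Only edges of [B] leaving [S] lose slack, and they lose [slack d], the minimum among them. *)
  + move=> e eB; rewrite /h'; have := feas e eB; have := slack_ge0 _ dB.
    case: ifP => hS'; case: ifP => tS' //; [by lra|by lra| |by lra].
    by have := dmin e; rewrite /P eB tS' hS' => /(_ isT); rewrite /slack; lra.
  + move=> e; rewrite !inE /h' => /orP[/eqP->|eA].
      by rewrite tS (negPf hS) /slack; lra.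
    by have [-> ->] := endS e eA; rewrite (tight e eA); lra.
Qed.

(** From left to right, zero lengths give a branching [B] inside [A]. An edge of [A] outside [B]
    would close an undirected cycle with paths of [B], so [A = B]. *)
Lemma arborescence_branching (H : digraph) (r0 : vertex H) (A : {set edge H}) :
  spanning_arborescence r0 A <-> branching r0 A.
Proof.
split; last exact: branching_tree.
move=> [[_ acA] reachA].
have [|_ [B [BA [reachB ltB] _ _]]] :=
  @shortest_path_tree int H r0 A (fun=> 0) _ reachA; first by [].
suff -> : A = B by [].
apply/eqP; rewrite eqEsubset BA andbT; apply/subsetP => d dA.
apply: contraT => dB; have /negP[] := acyclic_connect acA dA.
have sub x y : connect (arrow B) x y -> connect (adjacent (A :\ d)%SET) x y.
  apply: connect_sub => u v /arrowP[e eB [<- <-]]; apply: connect1.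
  rewrite /adjacent edge_arrow // !inE (subsetP BA) // andbT.
  by apply: contraNneq dB => <-.
have sym : connect_sym (adjacent (A :\ d)%SET).
  by apply: sym_connect_sym => {}x {}y; rewrite /adjacent orbC.
by apply: connect_trans (sub _ _ (reachB (tail d))); rewrite sym sub.
Qed.

(** * Path distances and the exchange of one edge *)

Section Distance.
Variables (H : digraph) (r0 : vertex H) (ell : edge H -> nat).
Hypothesis ell_gt0 : forall d, (0 < ell d)%N.
Implicit Types (A B C : {set edge H}).

Definition dist A r := (\sum_(d in path_edges A r) ell d)%N.

Lemma dist_root A : branching r0 A -> dist A r0 = 0%N.
Proof. by move=> brA; rewrite /dist (path_edges_root brA) big_set0. Qed.

Lemma dist_head A d : branching r0 A -> d \in A ->
  dist A (head d) = (dist A (tail d) + ell d)%N.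
Proof.
move=> brA dA; rewrite /dist (path_edges_head brA dA) big_setU1 /=.
  by rewrite addnC.
exact: path_edges_tail brA _ dA.
Qed.

Lemma le_dist A (g : vertex H -> nat) : branching r0 A -> g r0 = 0%N ->
  (forall d, d \in A -> g (head d) <= g (tail d) + ell d)%N ->
  forall r, (g r <= dist A r)%N.
Proof.
move=> brA g0 gA r; have [reachA _] := brA.
elim/connect_ind_r: (reachA r) => [|y z _ IH /arrowP[d dA [ty <-]]].
  by rewrite g0.
by rewrite dist_head // (leq_trans (gA d dA)) // leq_add2r ty.
Qed.

Lemma dist_le A (g : vertex H -> nat) : branching r0 A ->
  (forall d, d \in A -> g (tail d) + ell d <= g (head d))%N ->
  forall r, (dist A r <= g r)%N.
Proof.
move=> brA gA r; have [reachA _] := brA.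
elim/connect_ind_r: (reachA r) => [|y z _ IH /arrowP[d dA [ty <-]]].
  by rewrite dist_root.
by rewrite dist_head // (leq_trans _ (gA d dA)) // leq_add2r ty.
Qed.

(* [C] exchanges the edge of [A] entering [head d] for [d]. *)
Lemma shortcut A d : branching r0 A ->
  (dist A (tail d) + ell d < dist A (head d))%N ->
  exists C, [/\ branching r0 C, A :|: C = (d |: A)%SET &
                \sum_r dist C r < \sum_r dist A r]%N.
Proof.
move=> brA short; have [reachA ltA] := brA.
have dA : d \notin A.
  by apply: contraL short => dA; rewrite dist_head // ltnn.
have [e eA he] : exists2 e, e \in A & head e = head d.
  apply: in_edge (reachA _) _; apply: contraTneq short => ->.
  by rewrite dist_root.
pose C := (d |: A :\ e)%SET.
have brC : branching r0 C.
  split; last first.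
    by rewrite cardsU1 !inE (negPf dA) andbF add1n (cardsD1 e) eA in ltA *.
  (* Induction on the distance in [A]: each vertex other than [r0] is entered by an edge of [C] from
     a strictly closer vertex, with [d] taking over from [e]. *)
  move=> r; have [n] := ubnP (dist A r).
  elim: n r => // n IHn r; rewrite ltnS => rn.
  have [->|rN0] := eqVneq r r0; first exact: connect0.
  have [f fA hf] := in_edge (reachA r) rN0.
  have [g gC [hg tg]] : exists2 g, g \in C &
      head g = r /\ (dist A (tail g) < dist A r)%N.
    have [fe|fe] := eqVneq f e.
      exists d; rewrite ?inE ?eqxx // -hf fe he; split=> //.
      by apply: leq_ltn_trans short; apply: leq_addr.
    exists f; rewrite ?inE ?fe ?fA ?orbT // -hf; split=> //.
    by rewrite dist_head // -addn1 leq_add2l.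
  rewrite -hg; apply: connect_trans (IHn _ _) (connect1 (edge_arrow gC)).
  exact: leq_trans tg rn.
have CA : forall f, f \in C -> (dist A (tail f) + ell f <= dist A (head f))%N.
  move=> f; rewrite !inE => /orP[/eqP->|/andP[_ fA]]; first exact: ltnW.
  by rewrite dist_head.
have leC := dist_le brC CA.
exists C; split=> //.
  apply/setP => f; rewrite !inE.
  by case: (f == d); case: (f == e); case: (f \in A).
(* Distances in [C] are nowhere larger, and [d] makes that of [head d] strictly smaller. *)
rewrite (bigD1 (head d)) //= [X in (_ < X)%N](bigD1 (head d)) //=.
rewrite -addSn leq_add ?leq_sum //.
rewrite dist_head ?(leq_ltn_trans _ short) ?leq_add2r ?inE ?eqxx //.
Qed.

End Distance.

(** * Binary edge lengths and the comparison of two arborescences *)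

Lemma binary_expansion_inj n (b c : 'I_n -> bool) :
  (\sum_(i < n) b i * 2 ^ i = \sum_(i < n) c i * 2 ^ i)%N -> b =1 c.
Proof.
elim: n b c => [|n IHn] b c; first by move=> _ [].
rewrite !big_ord_recl !expn0 !muln1.
have half (f : 'I_n.+1 -> bool) :
    (\sum_(i < n) f (lift ord0 i) * 2 ^ lift ord0 i =
     (\sum_(i < n) f (lift ord0 i) * 2 ^ i).*2)%N.
  rewrite -mul2n big_distrr /=; apply: eq_bigr => i _.
  by rewrite /bump leq0n add1n expnS mulnCA.
(* Parity isolates the lowest digit; the remaining sums are halved. *)
rewrite !half => eq_bc; have b0c0 : b ord0 = c ord0.
  by have := congr1 odd eq_bc; rewrite !oddD !odd_double !addbF !oddb.
move: eq_bc; rewrite b0c0 => /addnI/double_inj/IHn bc i.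
by case: (unliftP ord0 i) => [j ->|->].
Qed.

(* With these lengths a distance determines the set of edges of the path, so that
   distinct arborescences have distinct distance functions. *)
Definition binary_weight (T : finType) (x : T) : nat := 2 ^ enum_rank x.

Lemma binary_weight_inj (T : finType) (S S' : {set T}) :
  (\sum_(x in S) binary_weight x = \sum_(x in S') binary_weight x)%N -> S = S'.
Proof.
have expand (U : {set T}) : (\sum_(x in U) binary_weight x =
    \sum_(i < #|T|) (enum_val i \in U) * 2 ^ i)%N.
  rewrite big_mkcond (reindex (@enum_val T T)) /=; last first.
    by apply: onW_bij; apply: enum_val_bij.
  apply: eq_bigr => i _; rewrite /binary_weight enum_valK.
  by case: (_ \in U); rewrite ?mul1n ?mul0n.
rewrite !expand => /binary_expansion_inj eqS; apply/setP => x.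
by have := eqS (enum_rank x); rewrite enum_rankK.
Qed.

Definition total_dist (H : digraph) (A : {set edge H}) : nat :=
  \sum_r dist (@binary_weight (edge H)) A r.

(** If no edge of [B] is a shortcut, distances in [A] are at most those in [B], and comparing the
    totals makes them equal. Binary lengths then identify all paths from the root; since an edge
    belongs to an arborescence exactly when it lies on the path to its head, [A = B]. *)
Lemma branching_exchange (H : digraph) (r0 : vertex H) (A B : {set edge H}) :
  branching r0 A -> branching r0 B -> A != B ->
  (total_dist B <= total_dist A)%N ->
  exists d C, [/\ d \in B, d \notin A, branching r0 C,
    A :|: C = (d |: A)%SET & (total_dist C < total_dist A)%N].
Proof.
move=> brA brB AB leBA; pose ell := @binary_weight (edge H).
have ell_gt0 d : (0 < ell d)%N by rewrite expn_gt0.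
case: (pickP [pred d in B | dist ell A (tail d) + ell d < dist ell A (head d)])%N.
  move=> d /andP[dB short]; have [C [brC AC ltC]] := shortcut ell_gt0 brA short.
  exists d, C; split=> //.
  by apply: contraL short => dA; rewrite (dist_head ell brA) // ltnn.
move=> noshort.
have leAB := @le_dist _ _ ell B (dist ell A) brB (dist_root ell brA).
have {}leAB r : (dist ell A r <= dist ell B r)%N.
  by apply: leAB => d dB; rewrite leqNgt; have := noshort d; rewrite /= dB /= => ->.
have eqd r : dist ell A r = dist ell B r.
  have [leS eqS] := leqif_sum (fun r (_ : true) => leqif_eq (leAB r)).
  move: eqS; rewrite eqn_leq leS leBA => /esym/forallP/(_ r).
  by move=> /implyP/(_ isT)/eqP.
have eqp r : path_edges A r = path_edges B r by apply/binary_weight_inj/eqd.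
case/eqP: AB; apply/setP => d.
have inP (X : {set edge H}) : (d \in path_edges X (head d)) = (d \in X).
  by rewrite inE connect0 andbT.
by rewrite -inP eqp inP.
Qed.

From mathcomp Require Import zify finmap boolp classical_sets reals.

(** * Regions of a plane bipartite graph *)

Section PlaneBipartite.
Variable G : bimap.
Implicit Types d : bedge G.

Lemma endE_rotE d : endE (rotE G d) = endE d.
Proof.
by apply/eqP; have := mem_porbit (rotE G) 1 d; rewrite porbit_rotE inE expg1.
Qed.

Lemma endV_rotV d : endV (rotV G d) = endV d.
Proof.
by apply/eqP; have := mem_porbit (rotV G) 1 d; rewrite porbit_rotV inE expg1.
Qed.

Lemma right_region_rotE d : right_region (rotE G d) = left_region d.
Proof.
apply/val_inj/eqP; rewrite /= -permM eq_porbit_mem.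
by have := mem_porbit (face_perm G) 1 d; rewrite expg1.
Qed.

(** The dual edges crossing the edges at one vertex of [G] form a directed closed walk, so the
    regions around this vertex reach each other. Connectedness of [G] carries this from vertex to
    vertex. *)
Lemma region_connected : connected_bimap G -> forall r r' : region G,
  connect (@arrow (dual_graph G) [set: bedge G]%SET) r r'.
Proof.
move=> G_conn r r'; set e := arrow _.
have cross d : connect e (left_region d) (right_region d).
  by apply/connect1/(@edge_arrow (dual_graph G)); rewrite inE.
have turnV d d' : endV d = endV d' -> connect e (left_region d) (left_region d').
  move=> dd'; have : d' \in porbit (rotV G) d by rewrite porbit_rotV inE dd'.
  move=> /porbitP[n ->]; elim: n => [|n IHn]; first by rewrite expg0 perm1.
  by rewrite expgSr permM; apply: connect_trans IHn (cross _).
have turnE d d' : endE d = endE d' -> connect e (left_region d) (left_region d').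
  move=> dd'; have : d \in porbit (rotE G) d' by rewrite porbit_rotE inE dd'.
  move=> /porbitP[n ->]; elim: n => [|n IHn]; first by rewrite expg0 perm1.
  rewrite expgSr permM; apply: connect_trans IHn.
  by rewrite -[X in connect _ _ X]right_region_rotE.
have leftc d d' : connect e (left_region d) (left_region d').
  pose inc (x : colE G + colV G) (d1 : bedge G) :=
    if x is inl y then endE d1 = y else
    if x is inr y then endV d1 = y else False.
  suff all_inc x : forall d1, inc x d1 -> connect e (left_region d) (left_region d1).
    exact: (all_inc (inl (endE d'))).
  elim/connect_ind_r: (G_conn (inl (endE d)) x) => [d1 /= /esym|]; first exact: turnE.
  move=> y z _ IH /orP[] /arrowP[f _ [/= fy fz]]; subst y z => d1 /= d1f.
  - exact: connect_trans (IH f erefl) (turnV _ _ (esym d1f)).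
  - exact: connect_trans (IH f erefl) (turnE _ _ (esym d1f)).
have [G0|GN0] := eqVneq #|bedge G| 0%N.
  suff -> : r = r' by apply: connect0.
  case: r r' => [x xr] [y yr]; apply/val_inj => /=; move: xr yr.
  by rewrite /regions G0 /= !inE => /eqP-> /eqP->.
have left_of (s : region G) : exists d, s = left_region d.
  have [d _ sd] : exists2 d, d \in [set: bedge G]%SET & val s = porbit (face_perm G) d.
    case: s => x /=; rewrite /regions (negPf GN0) => /imsetP[d _ ->].
    by exists d; rewrite ?inE.
  by exists d; apply/val_inj.
by have [d ->] := left_of r; have [d' ->] := left_of r'.
Qed.

Lemma card_region : #|region G| = #|regions G|.
Proof. by rewrite card_sig; apply: eq_card => r. Qed.

(** * Real 1-cycles and coboundaries *)

Section Boundary.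
Variable R : realType.
Implicit Types (f : bedge G -> R) (g : region G -> R).

(** With the V-coordinates negated, this is the usual boundary of a 1-chain with edges oriented
    between the colour classes; its kernel is the cycle space of [G]. *)
Definition boundary f : point_space R G := \sum_d f d *: edge_point R d.

Lemma boundaryE f e : boundary f (inl e) = \sum_(d | endE d == e) f d.
Proof.
rewrite /boundary sum_ffunE [RHS]big_mkcond; apply: eq_bigr => d _.
rewrite !ffunE (_ : (inl e == inr _) = false) // addr0 eq_sym.
rewrite (_ : (inl _ == inl _) = (endE d == e)) //.
by case: eqP => _; [apply: mulr1 | apply: mulr0].
Qed.

Lemma boundaryV f v : boundary f (inr v) = \sum_(d | endV d == v) f d.
Proof.
rewrite /boundary sum_ffunE [RHS]big_mkcond; apply: eq_bigr => d _.
rewrite !ffunE (_ : (inr v == inl _) = false) // add0r eq_sym.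
rewrite (_ : (inr _ == inr _) = (endV d == v)) //.
by case: eqP => _; [apply: mulr1 | apply: mulr0].
Qed.

Lemma boundaryD f1 f2 : boundary (fun d => f1 d + f2 d) = boundary f1 + boundary f2.
Proof. by rewrite -big_split; apply: eq_bigr => d _; rewrite scalerDl. Qed.

Lemma boundaryB f1 f2 : boundary (fun d => f1 d - f2 d) = boundary f1 - boundary f2.
Proof. by rewrite -sumrB; apply: eq_bigr => d _; rewrite scalerBl. Qed.

Lemma sum_boundaryE f : \sum_e boundary f (inl e) = \sum_d f d.
Proof.
rewrite [RHS](partition_big (@endE G) predT) //=.
by apply: eq_bigr => e _; rewrite boundaryE.
Qed.

Lemma sum_boundaryV f : \sum_v boundary f (inr v) = \sum_d f d.
Proof.
rewrite [RHS](partition_big (@endV G) predT) //=.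
by apply: eq_bigr => v _; rewrite boundaryV.
Qed.

(** Around a vertex, consecutive edges share a region that is left of one and right of the other, so
    reindexing by the rotation cancels all terms. *)
Lemma boundary_coboundary g :
  boundary (fun d => g (left_region d) - g (right_region d)) = 0.
Proof.
apply/ffunP => -[e|v]; rewrite ?boundaryE ?boundaryV ffunE sumrB.
  rewrite [X in _ - X](reindex_inj (@perm_inj _ (rotE G))) /=.
  apply/eqP; rewrite subr_eq0; apply/eqP/eq_big => d.
    by rewrite endE_rotE.
  by rewrite right_region_rotE.
rewrite [X in X - _](reindex_inj (@perm_inj _ (rotV G))) /=.
apply/eqP; rewrite subr_eq0; apply/eqP/eq_big => d //.
by rewrite endV_rotV.
Qed.

Lemma sum_delta (T : finType) (F : T -> R) y : \sum_x F x * (x == y)%:R = F y.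
Proof.
rewrite (bigD1 y) //= eqxx mulr1 big1 ?addr0 // => x /negPf->.
exact: mulr0.
Qed.

Lemma rank_corank1 m n (M : 'M[R]_(m, n)) (s : 'rV_m) :
  (forall u : 'rV_m, u *m M = 0 -> (u <= s)%MS) -> (m <= (\rank M).+1)%N.
Proof.
move=> Ms; have le1 : (\rank (kermx M) <= 1)%N.
  apply: leq_trans (rank_leq_row s); apply/mxrankS/row_subP => i.
  by apply/Ms/sub_kermxP/row_sub.
by move: le1; rewrite mxrank_ker leq_subLR addn1.
Qed.

Hypotheses (G_connected : connected_bimap G) (G_planar : planar G).

(** The empty graph is given one region, and Euler's formula would read 1 = 2. *)
Lemma vertex_card_gt0 : (0 < #|vertex (bigraph G)|)%N.
Proof.
have [x _|noV] := pickP (fun _ : vertex (bigraph G) => true).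
  by apply/card_gt0P; exists x.
have noE : #|bedge G| = 0%N.
  by apply: eq_card0 => d; have := noV (inl (endE d)).
have E0 : #|colE G| = 0%N by apply: eq_card0 => e; have := noV (inl e).
have V0 : #|colV G| = 0%N by apply: eq_card0 => v; have := noV (inr v).
by move: G_planar; rewrite /planar /regions E0 V0 noE eqxx cards1.
Qed.

(* The coboundaries lie in the kernel of the boundary map; by Euler's formula both
   spaces have the same dimension. *)
Lemma boundary0_coboundary f : boundary f = 0 ->
  exists g, forall d, f d = g (left_region d) - g (right_region d).
Proof.
move=> f0.
pose D : 'M[R]_(#|region G|, #|bedge G|) := \matrix_(i, j)
  ((left_region (enum_val j) == enum_val i)%:R -
   (right_region (enum_val j) == enum_val i)%:R).
pose X := vertex (bigraph G).
pose B : 'M[R]_(#|X|, #|bedge G|) :=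
  \matrix_(i, j) (edge_point R (enum_val j) : point_space R G) (enum_val i).
have sumI (T : finType) (F : T -> R) : \sum_x F x = \sum_(i < #|T|) F (enum_val i).
  by apply: reindex; apply/onW_bij/enum_val_bij.
have mulB (F : bedge G -> R) i :
    ((\row_j F (enum_val j)) *m B^T) 0 i = boundary F (enum_val i).
  rewrite mxE /boundary sum_ffunE [RHS]sumI; apply: eq_bigr => j _.
  by rewrite !mxE !ffunE.
have mulD (u : 'rV_#|region G|) j : (u *m D) 0 j =
    u 0 (enum_rank (left_region (enum_val j))) -
    u 0 (enum_rank (right_region (enum_val j))).
  rewrite mxE -[X in X - _](sum_delta (fun r => u 0 (enum_rank r))).
  rewrite -[X in _ - X](sum_delta (fun r => u 0 (enum_rank r))) -sumrB [RHS]sumI.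
  by apply: eq_bigr => i _; rewrite mxE enum_valK -mulrBr !(eq_sym (enum_val i)).
have DB : D *m B^T = 0.
  apply/row_matrixP => i; rewrite row_mul row0; apply/rowP => k.
  pose g (r : region G) : R := (r == enum_val i)%:R.
  have -> : row i D = \row_j (fun d => g (left_region d) - g (right_region d)) (enum_val j).
    by apply/rowP => j; rewrite !mxE.
  rewrite (mulB (fun d => g (left_region d) - g (right_region d))).
  by rewrite boundary_coboundary ffunE mxE.
(* The left kernel of [D] consists of the functions constant along dual edges, which are constant
   because the dual is connected. *)
have rD : (#|region G| <= (\rank D).+1)%N.
  apply: (@rank_corank1 _ _ _ (const_mx 1)) => u u0.
  have [r0 _|noR] := pickP (fun _ : region G => true); last first.
    rewrite (_ : u = 0) ?sub0mx //; apply/rowP => i.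
    by have := noR (enum_val i).
  suff -> : u = u 0 (enum_rank r0) *: const_mx 1 by apply: scalemx_sub.
  apply/rowP => i; rewrite !mxE mulr1.
  have := region_connected G_connected r0 (enum_val i).
  rewrite -{2}[i]enum_valK; move: (enum_val i) => r.
  elim/connect_ind_r => // y z _ <- /arrowP[d _ [/= <- <-]].
  have := mulD u (enum_rank d); rewrite u0 mxE enum_rankK.
  by move/esym/eqP; rewrite subr_eq0 => /eqP.
(* The left kernel of [B] consists of the functions changing sign along every edge; as [G] is
   connected, they are multiples of [sgn]. *)
have rB : (#|X| <= (\rank B).+1)%N.
  have /card_gt0P[x0 _] := vertex_card_gt0.
  pose sgn (x : X) : R := if x is inl _ then 1 else -1.
  apply: (@rank_corank1 _ _ _ (\row_i sgn (enum_val i))) => u u0.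
  have u0E d : u 0 (enum_rank (inl (endE d) : X)) = - u 0 (enum_rank (inr (endV d) : X)).
    apply/eqP; rewrite -addr_eq0; apply/eqP.
    rewrite -(sum_delta (fun x : X => u 0 (enum_rank x)) (inl (endE d))).
    rewrite -(sum_delta (fun x : X => u 0 (enum_rank x)) (inr (endV d))).
    rewrite -big_split [LHS]sumI /=.
    have := congr1 (fun v : 'rV_#|bedge G| => v 0 (enum_rank d)) u0.
    rewrite !mxE => u0d; rewrite -[RHS]u0d; apply: eq_bigr => i _.
    by rewrite mxE enum_valK enum_rankK -mulrDr !ffunE.
  suff -> : u = (sgn x0 * u 0 (enum_rank x0)) *: (\row_i sgn (enum_val i)).
    by apply: scalemx_sub.
  apply/rowP => i; rewrite !mxE -{1}[i]enum_valK.
  have := G_connected x0 (enum_val i); move: (enum_val i) => x.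
  have sgn2 y : sgn y * sgn y = 1 by case: y => ?; rewrite /sgn /=; lra.
  elim/connect_ind_r => [|y z _ IH].
    by rewrite mulrAC sgn2 mul1r.
  by move=> /orP[] /arrowP[d _ [/= ty hz]]; subst y z; move: IH;
    rewrite u0E /=; lra.
have DK : (D <= kermx B^T)%MS by apply/sub_kermxP.
(* The kernel has dimension [#|bedge G| - \rank B], at most [#|region G| - 1] by Euler's formula,
   and [D] has at least that rank. *)
have KD : (kermx B^T <= D)%MS.
  rewrite -(mxrank_leqif_sup DK).2 eqn_leq (mxrank_leqif_sup DK).1 mxrank_ker.
  rewrite mxrank_tr leq_subLR; move: rD rB G_planar; rewrite /planar -card_region.
  have cX : #|X| = (#|colE G| + #|colV G|)%N := card_sum _ _.
  lia.
have : ((\row_j f (enum_val j)) <= D)%MS.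
  apply: submx_trans KD; apply/sub_kermxP/rowP => k.
  by rewrite mulB f0 ffunE mxE.
move=> /submxP[u uD]; exists (fun r => u 0 (enum_rank r)) => d.
by have := mulD u (enum_rank d); rewrite -uD mxE enum_rankK.
Qed.

End Boundary.
End PlaneBipartite.

Lemma card_branching (H : digraph) (r0 : vertex H) (A : {set edge H}) :
  branching r0 A -> #|vertex H| = #|A|.+1.
Proof.
move=> brA; have [heads inj] := branching_heads brA.
rewrite -(card_in_imset inj) heads cardsC1 prednK //.
by apply/card_gt0P; exists r0.
Qed.

(** * Convex combinations of edge points and the root polytope *)

Section EdgePoints.
Variables (R : realType) (G : bimap).
Implicit Types (S : {set bedge G}) (a : bedge G -> R).
Local Notation pt := (@edge_point R G).
Local Open Scope classical_set_scope.

Lemma enum_finmem_perm S : perm_eq (enum_finmem (mem S)) (enum S).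
Proof.
by apply: uniq_perm; rewrite ?enum_finmem_uniq ?enum_uniq.
Qed.

Lemma sum_edge_points (V : nmodType) S (F : point_space R G -> V) :
  {in S &, injective pt} -> \sum_(p <- edge_points R S) F p = \sum_(d in S) F (pt d).
Proof.
move=> inj; rewrite big_imfset //= -[RHS]big_enum.
exact/perm_big/enum_finmem_perm.
Qed.

Lemma card_edge_points S : {in S &, injective pt} -> #|` edge_points R S| = #|S|.
Proof.
move=> inj; rewrite card_in_imfset //= cardE.
exact/perm_size/enum_finmem_perm.
Qed.

Lemma edge_points_sub S S' : S \subset S' -> (edge_points R S `<=` edge_points R S')%fset.
Proof.
move=> /fintype.subsetP SS'; apply/fsubsetP => p /imfsetP[d dS ->].
by apply: in_imfset; apply: SS'.
Qed.

Definition convex_coefs S a :=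
  [/\ forall d, 0 <= a d, forall d, d \notin S -> a d = 0 & \sum_d a d = 1].

Lemma sum_supported (V : nmodType) S (F : bedge G -> V) :
  (forall d, d \notin S -> F d = 0) -> \sum_d F d = \sum_(d in S) F d.
Proof.
move=> F0; rewrite [RHS]big_mkcond; apply: eq_bigr => d _.
by case: ifP => // /negbT/F0.
Qed.

(* Coefficients are indexed by edges; since parallel edges give the same point, the
   direct implication chooses one edge for each point. *)
Lemma conv_edge_points S x :
  conv (edge_points R S) x <-> exists2 a, convex_coefs S a & x = boundary a.
Proof.
split=> [[w [w0 w1 ->]]|[a [a0 aS a1] ->]].
  pose rep p := [pick d in S | pt d == p].
  pose S' := [set d in S | rep (pt d) == Some d]%SET.
  have S'S : S' \subset S by apply/fintype.subsetP => d; rewrite inE => /andP[].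
  have inj : {in S' &, injective pt}.
    move=> d d'; rewrite !inE => /andP[_ /eqP rd] /andP[_ /eqP rd'] dd'.
    by move: rd; rewrite dd' rd' => -[].
  have SS' : edge_points R S = edge_points R S'.
    apply/eqP; rewrite eqEfsubset (edge_points_sub S'S) andbT.
    apply/fsubsetP => p /imfsetP[d dS ->].
    have : rep (pt d) = rep (pt d) by [].
    rewrite {2}/rep; case: pickP => [d' /andP[d'S /eqP dd']|/(_ d)]; last first.
      by rewrite dS eqxx.
    by move=> rd; rewrite -dd' in_imfset //= inE d'S dd' rd eqxx.
  rewrite SS' !(sum_edge_points _ inj) in w1 *.
  exists (fun d => if d \in S' then w (pt d) else 0); last first.
    rewrite /boundary (@sum_supported _ S') => [|d /negPf->]; last exact: scale0r.
    by apply: eq_bigr => d ->.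
  split=> [d|d dS|].
  - case: ifP => // dS'; apply: w0; apply: in_imfset; exact: (fintype.subsetP S'S).
  - by rewrite ifN //; apply: contra dS; apply: (fintype.subsetP S'S).
  - by rewrite -big_mkcond.
(* Parallel edges pool their coefficients at the common point. *)
pose w p := \sum_(d in S | pt d == p) a d.
have sumw (V : lmodType R) (F : point_space R G -> V) :
    \sum_(p <- edge_points R S) w p *: F p = \sum_d a d *: F (pt d).
  rewrite (@sum_supported _ S) => [|d /aS->]; last exact: scale0r.
  under eq_bigr do rewrite scaler_suml big_mkcondr.
  rewrite exchange_big; apply: eq_bigr => d dS /=.
  rewrite (bigD1_seq (pt d)) ?fset_uniq ?in_imfset //= eqxx big1 ?addr0 // => p.
  by rewrite eq_sym => /negPf->.
exists w; split.
- by move=> p _; apply: sumr_ge0 => d _.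
- have := sumw R^o (fun=> 1).
  under eq_bigr do rewrite /GRing.scale /= mulr1.
  by move=> ->; rewrite -[RHS]a1; apply: eq_bigr => d _; apply: mulr1.
- by rewrite sumw.
Qed.

Lemma root_polytopeP x :
  root_polytope R G x <-> exists2 a, convex_coefs [set: bedge G]%SET a & x = boundary a.
Proof. exact: conv_edge_points. Qed.

Lemma root_polytope_coord x : root_polytope R G x ->
  [/\ forall y, 0 <= x y, \sum_e x (inl e) = 1 & \sum_v x (inr v) = 1].
Proof.
move=> /root_polytopeP[a [a0 _ a1] ->].
split; [|by rewrite sum_boundaryE|by rewrite sum_boundaryV].
by case=> y; rewrite ?boundaryE ?boundaryV sumr_ge0.
Qed.

Lemma edge_point_in_root_polytope d : root_polytope R G (pt d).
Proof.
apply/root_polytopeP; exists (fun d' => (d' == d)%:R).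
  split=> [d'|d'|]; rewrite ?inE ?ler0n //.
  rewrite (bigD1 d) //= eqxx big1 ?addr0 // => d' /negPf->//.
rewrite /boundary (bigD1 d) //= eqxx scale1r big1 ?addr0 // => d' /negPf->.
exact: scale0r.
Qed.

Lemma edge_point_extreme d : polytope_vertex (root_polytope R G) (pt d).
Proof.
split; first exact: edge_point_in_root_polytope.
(* A coordinate vanishing at [pt d] vanishes at [x], and the others are then
   determined by the two coordinate sums. *)
suff half (x y : point_space R G) (a : R) : root_polytope R G x -> root_polytope R G y ->
    0 < a < 1 -> pt d = a *: x + (1 - a) *: y -> x = pt d.
  move=> x y a Qx Qy a01 pE; split; first exact: half pE.
  apply: (half y x (1 - a)) => //; first by lra.
  by rewrite pE addrC; congr (_ + _ *: _); lra.
move=> Qx Qy /andP[a0 a1] pE.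
have [x0 xE xV] := root_polytope_coord Qx; have [y0 _ _] := root_polytope_coord Qy.
have xz z : pt d z = 0 -> x z = 0.
  rewrite pE !ffunE => /eqP.
  rewrite paddr_eq0 ?mulr_ge0 ?subr_ge0 ?x0 ?y0 ?ltW //.
  by move=> /andP[+ _]; rewrite mulf_eq0 (gt_eqF a0) => /eqP.
have ptE e : pt d (inl e) = (e == endE d)%:R.
  by rewrite !ffunE (_ : (inl e == inr _) = false) // addr0.
have ptV v : pt d (inr v) = (v == endV d)%:R.
  by rewrite !ffunE (_ : (inr v == inl _) = false) // add0r.
apply/ffunP => -[e|v].
  have [->|ne] := eqVneq e (endE d); last by rewrite xz ptE (negPf ne).
  rewrite ptE eqxx -xE (bigD1 (endE d)) //= big1 ?addr0 // => e' ne.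
  by rewrite xz // ptE (negPf ne).
have [->|ne] := eqVneq v (endV d); last by rewrite xz ptV (negPf ne).
rewrite ptV eqxx -xV (bigD1 (endV d)) //= big1 ?addr0 // => v' ne.
by rewrite xz // ptV (negPf ne).
Qed.

(** On the polytope the E-coordinates sum to 1, which turns affine into linear independence. All its
    points are annihilated by the vector [s], 1 on E and -1 on V, so the rank is below [#|X|]. *)
Lemma affinely_independent_card (t : {fset point_space R G}) :
  (0 < #|vertex (bigraph G)|)%N ->
  [set` t] `<=` root_polytope R G -> affinely_independent t ->
  (#|` t| < #|vertex (bigraph G)|)%N.
Proof.
set X := vertex (bigraph G) => X0 tQ indep.
have sum_t (V : nmodType) (F : point_space R G -> V) :
    \sum_(p <- t) F p = \sum_(i < size t) F (nth 0 t i).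
  by rewrite (big_nth 0) big_mkord.
pose M : 'M[R]_(size t, #|X|) := \matrix_(i, j) (nth 0 t i : {ffun X -> R}) (enum_val j).
have freeM : row_free M.
  apply/inj_row_free => u u0.
  pose w (p : point_space R G) : R :=
    if insub (index p t) is Some i then u 0 i else 0.
  have wE (i : 'I_(size t)) : w (nth 0 t i) = u 0 i.
    by rewrite /w index_uniq ?fset_uniq // valK.
  have w0 : \sum_(p <- t) w p *: p = 0.
    apply/ffunP => x; rewrite sum_ffunE sum_t.
    have := congr1 (fun v : 'rV_#|X| => v 0 (enum_rank x)) u0.
    rewrite !mxE ffunE => u0x; rewrite -[RHS]u0x; apply: eq_bigr => i _.
    by rewrite !mxE ffunE wE enum_rankK.
  have w1 : \sum_(p <- t) w p = 0.
    transitivity (\sum_e (\sum_(p <- t) w p *: p : point_space R G) (inl e)).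
      under [RHS]eq_bigr do rewrite sum_ffunE.
      rewrite exchange_big /=; apply: eq_big_seq => p pt.
      have [_ pE _] := root_polytope_coord (tQ _ pt).
      under eq_bigr do rewrite ffunE.
      by rewrite -[LHS]mulr1 -pE mulr_sumr.
    by rewrite w0 big1 // => e _; rewrite ffunE.
  apply/rowP => i; rewrite mxE -wE.
  by apply: (indep w w1 w0); apply: mem_nth.
pose s : 'cV[R]_#|X| := \col_j (if enum_val j : X is inl _ then 1 else -1).
have Ms : M *m s = 0.
  apply/colP => i; rewrite !mxE.
  have [_ pE pV] := root_polytope_coord (tQ _ (mem_nth 0 (ltn_ord i))).
  transitivity (\sum_(x : X) (nth 0 t i : {ffun X -> R}) x * (if x is inl _ then 1 else -1)).
    rewrite [RHS](reindex (@enum_val X X)) /=; last exact/onW_bij/enum_val_bij.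
    by apply: eq_bigr => j _; rewrite !mxE.
  rewrite big_sumType /= -mulr_suml -mulr_suml pE pV; lra.
have rs : (0 < \rank s)%N.
  rewrite lt0n mxrank_eq0; apply/eqP => s0.
  have /card_gt0P[x _] := X0; have := congr1 (fun v : 'cV_#|X| => v (enum_rank x) 0) s0.
  by rewrite !mxE; case: (enum_val _) => ? /eqP; rewrite ?oppr_eq0 oner_eq0.
have := mulmx0_rank_max Ms; move: freeM => /eqP->; rewrite [size _]/(#|` t|); lia.
Qed.

End EdgePoints.

(** * The triangulation by dual trees of arborescences *)

Section Triangulation.
Variables (R : realType) (G : bimap).
Hypotheses (G_connected : connected_bimap G) (G_planar : planar G).
Variable r0 : region G.
Local Notation pt := (@edge_point R G).
Local Notation tree := (@branching (dual_graph G) r0).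
Local Open Scope classical_set_scope.
Implicit Types (A B C : {set bedge G}) (a b : bedge G -> R).

(* The difference of the two coefficient vectors is the coboundary of some [g];
   [g] is monotone along the paths of both arborescences, in opposite directions,
   hence constant. *)
Lemma boundary_inj_branching A B a b : tree A -> tree B ->
  (forall d, 0 <= a d) -> (forall d, 0 <= b d) ->
  (forall d, d \in A -> a d = 0) -> (forall d, d \in B -> b d = 0) ->
  boundary a = boundary b -> a =1 b.
Proof.
move=> [reachA _] [reachB _] a0 b0 aA bB ab.
have [|g gE] := @boundary0_coboundary G R G_connected G_planar (fun d => a d - b d).
  by rewrite boundaryB ab subrr.
have geA r : g r0 <= g r.
  elim/connect_ind_r: (reachA r) => // y z _ IH /arrowP[d dA [/= dy dz]].
  by apply: le_trans IH _; have := gE d; rewrite dy dz aA //; have := b0 d; lra.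
have leB r : g r <= g r0.
  elim/connect_ind_r: (reachB r) => // y z _ IH /arrowP[d dB [/= dy dz]].
  by apply: le_trans IH; have := gE d; rewrite dy dz bB //; have := a0 d; lra.
have gc r : g r = g r0 by apply/eqP; rewrite eq_le geA leB.
by move=> d; apply/eqP; rewrite -subr_eq0 gE !gc subrr.
Qed.

(** A function [g] with coboundary [a] takes equal values at the ends of every edge of [A], hence is
    constant. This is the linear independence of the edge points of a dual tree. *)
Lemma boundary0_branching A a : tree A -> (forall d, d \in A -> a d = 0) ->
  boundary a = 0 -> forall d, a d = 0.
Proof.
move=> [reachA _] aA a0.
have [g gE] := @boundary0_coboundary G R G_connected G_planar a a0.
have gc r : g r = g r0.
  elim/connect_ind_r: (reachA r) => // y z _ <- /arrowP[d dA [/= <- <-]].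
  by have := gE d; rewrite aA // => /esym/eqP; rewrite subr_eq0 => /eqP.
by move=> d; rewrite gE !gc subrr.
Qed.

Lemma boundary_delta d : boundary (fun x => (x == d)%:R) = pt d.
Proof.
rewrite /boundary (bigD1 d) //= eqxx scale1r big1 ?addr0 // => x /negPf->.
exact: scale0r.
Qed.

(** The indicators of [d] and [d'] are nonnegative representations of one point, hence equal. In
    particular, a dual tree has no parallel edges. *)
Lemma edge_point_branching_inj A B d d' : tree A -> tree B ->
  d \notin A -> d' \notin B -> pt d = pt d' -> d = d'.
Proof.
move=> tA tB dA d'B dd'; apply/eqP.
have delta0 (C : {set bedge G}) e x : e \notin C -> x \in C -> (x == e)%:R = 0 :> R.
  by move=> eC xC; case: eqP eC => // <-; rewrite xC.
have := boundary_inj_branching tA tB (fun x => ler0n _ (x == d))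
  (fun x => ler0n _ (x == d')) (fun x => delta0 A d x dA)
  (fun x => delta0 B d' x d'B).
rewrite !boundary_delta => /(_ dd' d); rewrite eqxx.
by case: (d == d') => // /eqP; rewrite oner_eq0.
Qed.

Lemma edge_point_inj A : tree A -> {in ~: A &, injective pt}%SET.
Proof.
by move=> tA d d'; rewrite !inE => dA d'A; apply: (edge_point_branching_inj tA tA).
Qed.

Lemma edge_point_sub_inj A (S : {set bedge G}) :
  tree A -> S \subset (~: A)%SET -> {in S &, injective pt}.
Proof.
move=> tA /fintype.subsetP SA d d' dS d'S; exact: edge_point_inj tA _ _ (SA _ dS) (SA _ d'S).
Qed.

Lemma tree_affinely_independent A : tree A ->
  affinely_independent (edge_points R (~: A)%SET).
Proof.
move=> tA w _; rewrite (sum_edge_points _ (edge_point_inj tA)) => w0 p.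
move=> /imfsetP[d dA ->].
pose a d := if d \in A then 0 else w (pt d).
have aA x : x \in A -> a x = 0 by rewrite /a => ->.
have a0 : boundary a = 0.
  rewrite /boundary (@sum_supported _ _ (~: A)%SET) => [|x]; last first.
    by rewrite inE negbK => /aA->; apply: scale0r.
  by rewrite -[RHS]w0; apply: eq_bigr => x; rewrite /a inE => /negPf->.
have := boundary0_branching tA aA a0 d.
by move: dA; rewrite /a /= inE => /negPf->.
Qed.

(** This is Euler's formula, [A] having one edge fewer than there are regions. *)
Lemma card_tree A : tree A ->
  (#|` edge_points R (~: A)%SET|.+1 = #|vertex (bigraph G)|)%N.
Proof.
move=> tA; rewrite (card_edge_points (edge_point_inj tA)).
have cA : #|region G| = #|A|.+1 := card_branching tA.
have cC : (#|A| + #|~: A|%SET)%N = #|bedge G| := cardsC A.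
have cX : #|vertex (bigraph G)| = (#|colE G| + #|colV G|)%N := card_sum _ _.
move: G_planar; rewrite /planar -card_region cX cA -cC; lia.
Qed.

(** The two coefficient vectors of a common point agree, so they vanish on both [A] and [B]. *)
Lemma conv_tree_meet A B : tree A -> tree B ->
  conv (edge_points R (~: A)%SET) `&` conv (edge_points R (~: B)%SET) =
  conv (edge_points R (~: (A :|: B))%SET).
Proof.
move=> tA tB; apply/seteqP; split=> x; last first.
  move=> /conv_edge_points[a [a0 aS a1] xE]; split; apply/conv_edge_points;
    exists a => //; split=> // d; rewrite inE negbK => dX; apply: aS;
    by rewrite !inE dX ?orbT.
move=> [/conv_edge_points[a [a0 aS a1] xa] /conv_edge_points[b [b0 bS b1] xb]].
have aA d : d \in A -> a d = 0 by move=> dA; rewrite aS // inE dA.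
have bB d : d \in B -> b d = 0 by move=> dB; rewrite bS // inE dB.
have ab := boundary_inj_branching tA tB a0 b0 aA bB (etrans (esym xa) xb).
apply/conv_edge_points; exists a => //; split=> // d.
by rewrite !inE negbK => /orP[/aA|dB] //; rewrite ab bB.
Qed.

(* The coefficients can be lowered to the slacks of shortest-path distances from
   [r0]. *)
Lemma conv_tree_cover a : (forall d, 0 <= a d) ->
  exists A b, [/\ tree A, forall d, 0 <= b d, forall d, d \in A -> b d = 0 &
                  boundary b = boundary a].
Proof.
move=> a0; have [|h [A [_ tA feas tight]]] :=
  @shortest_path_tree R (dual_graph G) r0 [set: bedge G]%SET a (fun d _ => a0 d).
  exact: region_connected.
exists A, (fun d => a d + (h (left_region d) - h (right_region d))); split=> //.
- by move=> d; have := feas d; rewrite inE /= => /(_ isT); lra.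
- by move=> d /tight /=; lra.
- by rewrite boundaryD boundary_coboundary addr0.
Qed.

Lemma tree_edge_points_inj A B : tree A -> tree B ->
  edge_points R (~: A)%SET = edge_points R (~: B)%SET -> A = B.
Proof.
move=> tA tB eqAB; apply/eqP; rewrite eqEcard.
have -> : #|A| = #|B|.
  by apply: succn_inj; apply: etrans (esym (card_branching tA)) (card_branching tB).
rewrite leqnn andbT; apply/fintype.subsetP => d dA; apply: contraT => dB.
have /imfsetP[d' /= d'A dd'] : pt d \in edge_points R (~: A)%SET.
  by rewrite eqAB; apply: in_imfset; rewrite /= inE.
move: d'A; rewrite inE => d'A.
by move: (d'A); rewrite -(edge_point_branching_inj tB tA dB d'A dd') dA.
Qed.

Lemma arborescence_simplicesP s :
  reflect (exists2 A, tree A & s = edge_points R (~: A)%SET)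
    (s \in arborescence_simplices R r0).
Proof.
apply: (iffP (imfsetP _ _ _ _)) => -[A] /=.
  rewrite inE => tA ->; exists A => //.
  exact: proj1 (@arborescence_branching (dual_graph G) r0 A) tA.
move=> tA ->; exists A => //; rewrite inE.
exact: proj2 (@arborescence_branching (dual_graph G) r0 A) tA.
Qed.

Lemma arborescence_triangulation :
  triangulation (root_polytope R G) (arborescence_simplices R r0).
Proof.
split.
- move=> s /arborescence_simplicesP[A tA ->]; split.
    exact: tree_affinely_independent.
  move=> t tQ tind; rewrite -ltnS card_tree //.
  by apply: affinely_independent_card; rewrite ?vertex_card_gt0.
- move=> s /arborescence_simplicesP[A _ ->] p /imfsetP[d _ ->].
  exact: edge_point_extreme.
- apply/seteqP; split=> x.
    move=> [s /arborescence_simplicesP[A _ ->]] /conv_edge_points[a [a0 aS a1] ->].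
    by apply/root_polytopeP; exists a => //; split=> // d; rewrite inE.
  move=> /root_polytopeP[a [a0 _ a1] ->].
  have [A [b [tA b0 bA ba]]] := conv_tree_cover a0.
  exists (edge_points R (~: A)%SET); first by apply/arborescence_simplicesP; exists A.
  apply/conv_edge_points; exists b => //; split=> //.
    by move=> d; rewrite inE negbK => /bA.
  (* The sum of the coefficients is read off the E-coordinates of the point, which is the same for
     [a] and [b]. *)
  by rewrite -sum_boundaryE ba sum_boundaryE.
- move=> s t /arborescence_simplicesP[A tA ->] /arborescence_simplicesP[B tB ->].
  rewrite /meet_in_common_face conv_tree_meet //.
  by split; exists (edge_points R (~: (A :|: B))%SET) => //;
    apply: edge_points_sub; rewrite finset.setCU ?subsetIl ?subsetIr.
Qed.

Lemma arborescence_pure : pure_simplicial_complex (arborescence_simplices R r0).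
Proof.
have [_ _ _ meet] := arborescence_triangulation.
split=> // [s /arborescence_simplicesP[A tA ->]|s t].
  exact: tree_affinely_independent.
move=> /arborescence_simplicesP[A tA ->] /arborescence_simplicesP[B tB ->].
by apply: succn_inj; rewrite !card_tree.
Qed.

(** * The shelling order *)

Local Notation tdist := (@total_dist (dual_graph G)).

Lemma arborescence_shellable : shellable (arborescence_simplices R r0).
Proof.
split; first exact: arborescence_pure.
pose simplex A := edge_points R (~: A)%SET.
pose le A B := (tdist A <= tdist B)%N.
have le_trans : transitive le by move=> A B C; apply: leq_trans.
(* Ties are broken arbitrarily: an earlier position gives only a weak inequality of totals, which
   suffices for [branching_exchange]. *)
pose L := sort le [seq A <- enum {set bedge G} | `[< tree A >]].
have memL A : A \in L <-> tree A.
  rewrite mem_sort mem_filter mem_enum andbT.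
  by split=> [/asboolP//|tA]; apply/asboolP.
have uniqL : uniq L by rewrite sort_uniq filter_uniq ?enum_uniq.
have sortL : sorted le L by apply: sort_sorted => A B; apply: leq_total.
have nthL j : (j < size L)%N -> tree (nth finset.set0 L j).
  by move=> jL; apply/memL/mem_nth.
exists (map simplex L); split.
- rewrite map_inj_in_uniq // => A B /memL tA /memL tB.
  exact: tree_edge_points_inj.
- move=> s; apply/mapP/arborescence_simplicesP => -[A tA ->];
    by exists A => //; apply/memL.
move=> i; rewrite size_map => iL; rewrite (nth_map finset.set0) //.
set A := nth finset.set0 L i; have tA : tree A by apply: nthL.
have before j : (j < i)%N -> [/\ (j < size L)%N, (tdist (nth finset.set0 L j) <= tdist A)%N
    & nth fset0 (map simplex L) j = simplex (nth finset.set0 L j)].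
  move=> ji; have jL := ltn_trans ji iL; split=> //; last by rewrite (nth_map finset.set0).
  exact: (sorted_ltn_nth le_trans finset.set0 sortL).
have earlier C : tree C -> (tdist C < tdist A)%N ->
    exists2 j, (j < i)%N & nth finset.set0 L j = C.
  move=> /memL CL ltCA; exists (index C L); last exact: nth_index.
  rewrite ltnNge; apply: contraL ltCA => ij; rewrite -leqNgt.
  have := sorted_leq_nth le_trans (fun B => leqnn _) finset.set0 sortL.
  by move=> /(_ i (index C L) iL _ ij); rewrite nth_index // inE index_mem; apply.
(* These [C] come earlier, and their simplices meet that of [A] in the facet opposite to [pt d]. *)
pose P C := tree C /\ (tdist C < tdist A)%N /\
  exists2 d, d \notin A & (A :|: C = d |: A)%SET.
pose F := [fset edge_points R (~: (A :|: C))%SET | C in [set C | `[< P C >]]%SET]%fset.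
have FP t : t \in F <-> exists2 C, P C & t = edge_points R (~: (A :|: C))%SET.
  split=> [/imfsetP[C /= CP ->]|[C CP ->]].
    by exists C => //; move: CP; rewrite inE => /asboolP.
  by apply: in_imfset; rewrite /= inE; apply/asboolP.
have subA C : (~: (A :|: C) \subset ~: A)%SET by rewrite finset.setCU subsetIl.
(* The intersection with any earlier simplex lies in a facet supplied by [P]. *)
have exchange j : (j < i)%N -> exists2 C, P C &
    (~: (A :|: nth finset.set0 L j) \subset ~: (A :|: C))%SET.
  move=> ji; have [jL leBA _] := before j ji.
  have AB : A != nth finset.set0 L j by rewrite nth_uniq // gtn_eqF.
  have [d [C [dB dA tC AC ltCA]]] := branching_exchange tA (nthL j jL) AB leBA.
  exists C; first by split=> //; split=> //; exists d.
  rewrite finset.setCS AC finset.subUset finset.sub1set finset.subsetUl andbT.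
  by rewrite !inE dB orbT.
exists F; split.
- move=> t /FP[C [tC [_ [d dA AC]]] ->]; split; first exact: edge_points_sub.
  rewrite /simplex (card_edge_points (edge_point_inj tA)).
  rewrite (card_edge_points (edge_point_sub_inj tA (subA C))) AC.
  rewrite (cardsD1 d) inE dA add1n; congr _.+1; apply: eq_card => x.
  by rewrite !inE negb_or.
- apply/seteqP; split=> x.
    move=> [xA [j /= ji]]; have [jL _ ->] := before j ji; move=> xB.
    have [C PC sub] := exchange j ji.
    exists (edge_points R (~: (A :|: C))%SET); first by apply/FP; exists C.
    have : (conv (simplex A) `&` conv (simplex (nth finset.set0 L j))) x by [].
    rewrite conv_tree_meet //; last exact: nthL.
    move=> /conv_edge_points[a [a0 aS a1] xa]; apply/conv_edge_points.
    exists a => //; split=> // d dC; apply: aS.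
    by apply: contra dC; apply: (fintype.subsetP sub).
  move=> [t /FP[C [tC [ltCA _]] ->]]; rewrite -conv_tree_meet // => -[xA xC].
  split=> //; have [j ji jC] := earlier C tC ltCA; exists j => //.
  by have [_ _ ->] := before j ji; rewrite jC.
(* Nothing precedes position 0, so [F] is empty there; for later positions the exchange against the
   simplex at position 0 supplies a facet. *)
- case: eqP => [i0|/eqP iN0].
    apply/eqP; rewrite cardfs_eq0; apply/eqP/fsetP => t; rewrite in_fset0.
    apply/negP => /FP[C [tC [ltCA _]] _].
    by have [j] := earlier C tC ltCA; rewrite i0.
  rewrite -lt0n in iN0; have [C PC _] := exchange 0%N iN0.
  rewrite cardfs_gt0; apply/fset0Pn.
  by exists (edge_points R (~: (A :|: C))%SET); apply/FP; exists C.
Qed.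

End Triangulation.

Theorem proposition1p2 (R : realType) (G : bimap)
    (G_connected : connected_bimap G) (G_planar : planar G) (r0 : region G) :
  triangulation (root_polytope R G) (arborescence_simplices R r0) /\
  shellable (arborescence_simplices R r0).
Proof.
by split; [apply: arborescence_triangulation | apply: arborescence_shellable].
Qed.
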